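(* Let $(\mathcal{X},d)$ be a metric space and let $f$, $g$, $h$ and $k$ be maps from $\mathcal{X}$ into itself. Suppose that each of the pairs $(f,h)$ and $(g,k)$ is either compatible and subsequentially continuous, or subcompatible and reciprocally continuous. Then (a) $f$ and $h$ have a coincidence point; (b) $g$ and $k$ have a coincidence point. Let moreover $\Phi:[0,\infty)\to[0,\infty)$ be a continuous function such that $\Phi(t)=0$ if and only if $t=0$, and suppose that for all $x,y\in\mathcal{X}$ $$\Phi(d(fx,gy))\leq a(d(hx,ky))\,\Phi(d(hx,ky))+b(d(hx,ky))\min\{\Phi(d(hx,gy)),\Phi(d(ky,fx))\},$$ where $a,b:[0,\infty)\to[0,1)$ are upper semi-continuous and satisfy $a(t)+b(t)<1$ for all $t>0$. Then $f$, $g$, $h$ and $k$ have a unique common fixed point.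
   Context: $fx$ denotes $f(x)$ and $fgx$ denotes $f(g(x))$. Let $f,g$ be self-maps of a metric space $(\mathcal{X},d)$. - $f$ and $g$ are compatible if $\lim_{n\to\infty}d(fgx_n,gfx_n)=0$ whenever $(x_n)$ is a sequence in $\mathcal{X}$ such that $\lim_{n\to\infty}fx_n=\lim_{n\to\infty}gx_n=t$ for some $t\in\mathcal{X}$. - $f$ and $g$ are subcompatible if there exists a sequence $(x_n)$ in $\mathcal{X}$ such that $\lim_{n\to\infty}fx_n=\lim_{n\to\infty}gx_n=t$ for some $t\in\mathcal{X}$ and $\lim_{n\to\infty}d(fgx_n,gfx_n)=0$. - $f$ and $g$ are reciprocally continuous if $\lim_{n\to\infty}fgx_n=ft$ and $\lim_{n\to\infty}gfx_n=gt$ whenever $(x_n)\subset\mathcal{X}$ is a sequence such that $\lim_{n\to\infty}fx_n=\lim_{n\to\infty}gx_n=t\in\mathcal{X}$. - $f$ and $g$ are subsequentially continuous if there exists a sequence $(x_n)$ in $\mathcal{X}$ such that $\lim_{n\to\infty}fx_n=\lim_{n\to\infty}gx_n=t$ for some $t\in\mathcal{X}$, $\lim_{n\to\infty}fgx_n=ft$ and $\lim_{n\to\infty}gfx_n=gt$. - A coincidence point of $f$ and $g$ is a point $x$ with $fx=gx$; a common fixed point of a family of self-maps is a point fixed by every map in the family. *)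

(* Defs.v *)
From mathcomp Require Import all_boot all_order all_algebra.
From mathcomp Require Import all_classical reals topology normedtype.

Set Implicit Arguments.
Unset Strict Implicit.
Unset Printing Implicit Defensive.

Import Order.TTheory GRing.Theory Num.Theory.
Import numFieldNormedType.Exports.

Local Open Scope classical_set_scope.
Local Open Scope ring_scope.

Definition compatible (R : realType) (X : metricType R) (f g : X -> X) : Prop :=
  forall (x : nat -> X) (t : X),
    f (x n) @[n --> \oo] --> t ->
    g (x n) @[n --> \oo] --> t ->
    mdist (f (g (x n))) (g (f (x n))) @[n --> \oo] --> (0 : R).

Definition subcompatible (R : realType) (X : metricType R) (f g : X -> X)
    : Prop :=
  exists (x : nat -> X) (t : X),
    [/\ f (x n) @[n --> \oo] --> t,
        g (x n) @[n --> \oo] --> t &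
        mdist (f (g (x n))) (g (f (x n))) @[n --> \oo] --> (0 : R)].

Definition reciprocally_continuous (R : realType) (X : metricType R)
    (f g : X -> X) : Prop :=
  forall (x : nat -> X) (t : X),
    f (x n) @[n --> \oo] --> t ->
    g (x n) @[n --> \oo] --> t ->
    f (g (x n)) @[n --> \oo] --> f t /\ g (f (x n)) @[n --> \oo] --> g t.

Definition subsequentially_continuous (R : realType) (X : metricType R)
    (f g : X -> X) : Prop :=
  exists (x : nat -> X) (t : X),
    [/\ f (x n) @[n --> \oo] --> t,
        g (x n) @[n --> \oo] --> t,
        f (g (x n)) @[n --> \oo] --> f t &
        g (f (x n)) @[n --> \oo] --> g t].

Definition coincidence_point (X : Type) (f g : X -> X) (x : X) : Prop :=
  f x = g x.

(* Upper semi-continuity of the restriction of u to A, for the topology induced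
   on A; the values of u outside A are irrelevant. *)
Definition upper_semicontinuous_on (R : realType) (A : set R) (u : R -> R)
    : Prop :=
  forall t, A t -> forall c : R, u t < c ->
    \forall s \near within A (nbhs t), u s < c.

(* Main.v *)
Require Import Defs.
From mathcomp Require Import all_boot all_order all_algebra.
From mathcomp Require Import all_classical reals topology normedtype.
From mathcomp Require Import lra.

(** In each hypothesis on a pair [(f, h)] one half provides a sequence along which
    [f] and [h] have a common limit [t], and the two halves together give
    [f h x_n --> f t], [h f x_n --> h t] and [d(f h x_n, h f x_n) --> 0], so that
    [f t = h t]. For the contractive part, the inequality is used only in the
    limit: if [f x_n], [h x_n] tend to [u] and [g y_n], [k y_n] tend to [v], then
    all the distances involved tend to [D = d(u, v)], whence
    [Phi D <= (a D + b D) Phi D] by semi-continuity, and so [D = 0]. Taking for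
    [x_n] and [y_n] either the sequences above or constant sequences yields all
    the required equalities, uniqueness included. *)

Set Implicit Arguments.
Unset Strict Implicit.
Unset Printing Implicit Defensive.

Import Order.TTheory GRing.Theory Num.Theory.
Import numFieldNormedType.Exports.

Local Open Scope classical_set_scope.
Local Open Scope ring_scope.

Lemma cvg_to_within (T U : Type) (F : set_system T) (G : set_system U)
    (A : set U) (p : T -> U) :
  Filter F -> (forall n, A (p n)) -> p @ F --> G -> p @ F --> within A G.
Proof.
move=> FF Ap pG P /pG; apply: (@filterS _ F) => n /= nP; exact: nP (Ap n).
Qed.

Lemma cvg_mdist (R : realType) (X : metricType R) (T : Type)
    (F : set_system T) (p q : T -> X) (u v : X) :
  Filter F -> p @ F --> u -> q @ F --> v ->
  mdist (p n) (q n) @[n --> F] --> mdist u v.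
Proof.
move=> FF pu qv; apply/cvgrPdist_lt => e e0.
have e2 : 0 < e / 2 by rewrite divr_gt0.
have pe := metricType_numDomainType.cvgr_dist_lt (FF := FF) pu e2.
have qe := metricType_numDomainType.cvgr_dist_lt (FF := FF) qv e2.
(* Four triangle inequalities, two for each sign, give [|d(u, v) - d(p n, q n)| <= d(u, p n) + d(v,
   q n)], and each summand is below [e / 2]. *)
apply: filterS2 pe qe => n pn qn; rewrite ltr_norml.
have := metric_triangle u (p n) v; have := metric_triangle (p n) (q n) v.
have := metric_triangle (p n) u (q n); have := metric_triangle u v (q n).
rewrite (metric_sym (p n) u) (metric_sym (q n) v).
by move: pn qn => *; apply/andP; split; lra.
Qed.

Lemma cvg_mdist0_eq (R : realType) (X : metricType R) (T : Type)
    (F : set_system T) (p q : T -> X) (u v : X) :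
  ProperFilter F -> p @ F --> u -> q @ F --> v ->
  mdist (p n) (q n) @[n --> F] --> (0 : R) -> u = v.
Proof.
move=> FF pu qv pq; apply: mdist_positivity.
exact: (cvg_unique _ (cvg_mdist _ pu qv) pq).
Qed.

Lemma common_limit_coincidence (R : realType) (X : metricType R)
    (f h : X -> X) :
  (compatible f h /\ subsequentially_continuous f h) \/
  (subcompatible f h /\ reciprocally_continuous f h) ->
  exists (x : nat -> X) (t : X),
    [/\ f (x n) @[n --> \oo] --> t, h (x n) @[n --> \oo] --> t & f t = h t].
Proof.
case=> [[fhC [x [t [fx hx fhx hfx]]]]|[[x [t [fx hx fhx]]] fhR]]; exists x, t.
- by split=> //; apply: cvg_mdist0_eq fhx hfx _; exact: fhC hx.
- have [fhxt hfxt] := fhR _ _ fx hx.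
  by split=> //; exact: cvg_mdist0_eq fhxt hfxt fhx.
Qed.

Section contraction.
Context (R : realType) (Phi a b : R -> R).
Hypothesis Phi_ge0 : forall t : R, 0 <= t -> 0 <= Phi t.
Hypothesis Phi_cont : {within `[0, +oo[, continuous Phi}.
Hypothesis Phi_eq0 : forall t : R, 0 <= t -> (Phi t = 0 <-> t = 0).
Hypothesis b_ge0 : forall t : R, 0 <= t -> 0 <= b t.
Hypothesis a_usc : upper_semicontinuous_on `[0, +oo[ a.
Hypothesis b_usc : upper_semicontinuous_on `[0, +oo[ b.
Hypothesis ab_lt1 : forall t : R, 0 < t -> a t + b t < 1.

Lemma contraction_limit_eq0 (T : Type) (F : set_system T) (p q r s : T -> R)
    (D : R) :
  ProperFilter F ->
  (forall n, 0 <= p n) -> (forall n, 0 <= q n) -> (forall n, 0 <= r n) ->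
  p @ F --> D -> q @ F --> D -> r @ F --> D ->
  (forall n, Phi (p n) <=
     a (q n) * Phi (q n) + b (q n) * Num.min (Phi (r n)) (Phi (s n))) ->
  D = 0.
Proof.
move=> FF p0 q0 r0 pD qD rD ineq.
have D_ge0 : 0 <= D by apply: (cvgr_to_ge pD); exact: nearW.
have DA : `[0, +oo[%classic D by rewrite /= in_itv /= D_ge0.
(* [Phi], [a] and [b] are controlled only on [[0, +oo[], so convergence to [D] has to be refined to
   the trace filter on that half-line. *)
have win (w : T -> R) : (forall n, 0 <= w n) -> w @ F --> D ->
    w @ F --> within `[0, +oo[%classic (nbhs D).
  by move=> w0 wD; apply: cvg_to_within => // n; rewrite /= in_itv /= w0.
have PhiD (w : T -> R) : (forall n, 0 <= w n) -> w @ F --> D ->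
    Phi (w n) @[n --> F] --> Phi D.
  move=> w0 wD; apply: cvg_comp (win _ w0 wD) _.
  exact: (subspace_continuousP _ _).1 Phi_cont D DA.
apply: contrapT => /eqP D_neq0.
have D_gt0 : 0 < D by rewrite lt_neqAle eq_sym D_neq0.
have PhiD_gt0 : 0 < Phi D.
  rewrite lt_neqAle Phi_ge0// andbT eq_sym; apply/eqP => /(Phi_eq0 D_ge0).
  exact/eqP.
have abD := ab_lt1 D_gt0.
(* A third of the gap below 1: raising both coefficients by [e] still leaves their sum at
   [1 - e]. *)
pose e := (1 - (a D + b D)) / 3.
have e0 : 0 < e by rewrite divr_gt0// subr_gt0.
(* The coefficients [a (q n)] and [b (q n)] may have no limit; semi-continuity bounds them
   eventually by constants, and the right-hand side then converges. *)
have aq : \forall n \near F, a (q n) < a D + e.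
  have c_gt : a D < a D + e by rewrite ltrDl.
  exact: (win _ q0 qD _ (a_usc DA c_gt)).
have bq : \forall n \near F, b (q n) < b D + e.
  have c_gt : b D < b D + e by rewrite ltrDl.
  exact: (win _ q0 qD _ (b_usc DA c_gt)).
have : Phi D <= (a D + e) * Phi D + (b D + e) * Phi D.
  have rhs : (a D + e) * Phi (q n) + (b D + e) * Phi (r n) @[n --> F] -->
      (a D + e) * Phi D + (b D + e) * Phi D.
    by apply: cvgD; apply: cvgMr; exact: PhiD.
  rewrite -subr_ge0; apply: (cvgr_to_ge (cvgB rhs (PhiD p p0 pD))).
  apply: filterS2 aq bq => n aqn bqn; rewrite /= subr_ge0.
  apply: le_trans (ineq n) _.
  apply: lerD; first by rewrite ler_wpM2r ?Phi_ge0// ltW.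
  (* The minimum is bounded by its first entry, which tends to [Phi D]. *)
  apply: (@le_trans _ _ (b (q n) * Phi (r n))).
    by rewrite ler_wpM2l ?b_ge0// ge_min lexx.
  by rewrite ler_wpM2r ?Phi_ge0// ltW.
(* Cancelling [Phi D > 0] would give [1 <= a D + b D + 2 e = 1 - e]. *)
rewrite -mulrDl ler_pMl// leNgt => /negP; apply.
by rewrite /e; lra.
Qed.

Lemma contraction_common_limit (X : metricType R) (f g h k : X -> X)
    (T : Type) (F : set_system T) (x y : T -> X) (u v : X) :
  ProperFilter F ->
  (forall x y : X,
    Phi (mdist (f x) (g y)) <=
      a (mdist (h x) (k y)) * Phi (mdist (h x) (k y)) +
      b (mdist (h x) (k y)) *
        Num.min (Phi (mdist (h x) (g y))) (Phi (mdist (k y) (f x)))) ->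
  f (x n) @[n --> F] --> u -> h (x n) @[n --> F] --> u ->
  g (y n) @[n --> F] --> v -> k (y n) @[n --> F] --> v -> u = v.
Proof.
move=> FF ineq fu hu gv kv; apply: mdist_positivity.
apply: (contraction_limit_eq0 FF _ _ _ (cvg_mdist _ fu gv)
  (cvg_mdist _ hu kv) (cvg_mdist _ hu gv) (fun n => ineq (x n) (y n))) => n;
  exact: mdist_ge0.
Qed.

End contraction.

Theorem mainTheorem3 (R : realType) (X : metricType R) (f g h k : X -> X)
    (fh : (compatible f h /\ subsequentially_continuous f h) \/
          (subcompatible f h /\ reciprocally_continuous f h))
    (gk : (compatible g k /\ subsequentially_continuous g k) \/
          (subcompatible g k /\ reciprocally_continuous g k)) :
  [/\ exists x : X, coincidence_point f h x,
      exists x : X, coincidence_point g k x &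
      forall Phi a b : R -> R,
        (forall t : R, 0 <= t -> 0 <= Phi t) ->
        {within `[0, +oo[, continuous Phi} ->
        (forall t : R, 0 <= t -> (Phi t = 0 <-> t = 0)) ->
        (forall t : R, 0 <= t -> 0 <= a t < 1) ->
        (forall t : R, 0 <= t -> 0 <= b t < 1) ->
        upper_semicontinuous_on `[0, +oo[ a ->
        upper_semicontinuous_on `[0, +oo[ b ->
        (forall t : R, 0 < t -> a t + b t < 1) ->
        (forall x y : X,
          Phi (mdist (f x) (g y)) <=
            a (mdist (h x) (k y)) * Phi (mdist (h x) (k y)) +
            b (mdist (h x) (k y)) *
              Num.min (Phi (mdist (h x) (g y))) (Phi (mdist (k y) (f x)))) ->
        exists! x : X, [/\ f x = x, g x = x, h x = x & k x = x]].
Proof.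
have [x [t [fx hx ft]]] := common_limit_coincidence fh.
have [y [s [gy ky gs]]] := common_limit_coincidence gk.
split; [by exists t | by exists s |].
move=> Phi a b Phi0 Phic PhiE _ b01 ausc busc ab1 ineq.
have b0 r : 0 <= r -> 0 <= b r by move=> /b01 /andP[].
have eq_lim (p q : nat -> X) (u v : X) := @contraction_common_limit R Phi a b
  Phi0 Phic PhiE b0 ausc busc ab1 X f g h k nat \oo p q u v
  eventually_filter ineq.
have cst (m : X -> X) (z w : X) : m z = w -> m z @[_ --> \oo] --> w.
  by move=> ->; exact: cvg_cst.
have ts : t = s := eq_lim _ _ _ _ fx hx gy ky.
(* The constant sequence [t] gives [f] and [h] the common limit [f t = h t], while [y] keeps the
   limit [t] for [g] and [k]. The next step exchanges the two pairs. *)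
subst s; have ftt : f t = t.
  by apply: (eq_lim (fun=> t) _ _ _ _ _ gy ky); apply: cst.
have tgt : t = g t.
  by apply: (eq_lim _ (fun=> t) _ _ fx hx); apply: cst.
exists t; split; first by split; rewrite -?ft -?gs ?ftt -?tgt.
(* With the constant sequences [t] and [z], the two common limits are [f t = h t] and [z]. *)
move=> z [_ gz _ kz]; rewrite -ftt.
by apply: (eq_lim (fun=> t) (fun=> z)); apply: cst.
Qed.
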